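(* Let $X$ be a non-empty compact metric space. The function $\Delta_{\mathrm{A}}: \mathcal{K}(X) \times (0,1) \to \mathbb{R}$ defined by \[ \Delta_{\mathrm{A}}(F,\theta) = \dim_{\mathrm{A}}^\theta F \] is of Baire class 2 and, in particular, Borel measurable. Moreover, it is not in general of Baire class 1.
   Context: $\mathcal{K}(X)$ is the set of all non-empty compact subsets of $X$ with the Hausdorff metric $d_{\mathcal H}(E,F)=\inf\{\varepsilon>0: E\subseteq F_\varepsilon \text{ and } F\subseteq E_\varepsilon\}$, where $E_\varepsilon$ is the $\varepsilon$-neighbourhood of $E$; $\mathcal{K}(X)\times(0,1)$ carries the product topology and any compatible metric. A function between metric spaces is Baire class $0$ if it is continuous, and Baire class $n+1$ if it is a pointwise limit of a sequence of Baire class $n$ functions. For a subset $E$ of a metric space and $r>0$, $N(E,r)$ denotes the minimal number of balls of radius $r$ required to cover $E$, and $B(x,R)$ is the ball of radius $R$ centred at $x$. For $\theta\in(0,1)$, the Assouad spectrum of $F$ at $\theta$ is \[ \dim_{\mathrm A}^{\theta} F = \inf\Big\{\alpha : \exists C>0,\ \exists \rho>0,\ \forall\, 0<R\leq\rho,\ \forall x\in F,\ N(B(x,R)\cap F,R^{1/\theta})\leq C \big(R/R^{1/\theta}\big)^{\alpha}\Big\}. \] *)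

(* Defs.v *)
From HB Require Import structures.
From mathcomp Require Import all_boot all_order all_algebra.
From mathcomp Require Import all_classical all_reals all_analysis.

Set Implicit Arguments.
Unset Strict Implicit.
Unset Printing Implicit Defensive.

Import Order.TTheory GRing.Theory Num.Theory.
Import numFieldNormedType.Exports.

Local Open Scope classical_set_scope.
Local Open Scope ring_scope.

Section hyperspace.
Context {R : realType}.

Record hyperspace (X : metricType R) := Hyperspace {
  hset :> set X;
  hset_neq0 : hset !=set0;
  hset_compact : compact hset }.
Arguments hset_neq0 {X} h.
Arguments hset_compact {X} h.

Context {X : metricType R}.
Implicit Types (E F G : set X) (e : R).

Definition set_nbhd E e : set X := [set y | exists2 x, E x & mdist x y < e].

Definition hausdorff_dist E F : R :=
  inf [set e | 0 < e /\ E `<=` set_nbhd F e /\ F `<=` set_nbhd E e].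

Lemma hyperspace_inj (E F : hyperspace X) : hset E = hset F -> E = F.
Proof.
case: E F => [E e1 e2] [F f1 f2] /= EF; subst F.
by congr Hyperspace; exact: Prop_irrelevance.
Qed.

Lemma compact_mdist_bounded E (x : X) : compact E ->
  exists2 M : R, 0 < M & forall y, E y -> mdist x y < M.
Proof.
move=> /compact_near_coveringP /(_ _ +oo%R (fun M y => mdist x y < M) _) H.
have [y _|M [_ HM]] := H.
  exists (ball y 1, [set M | mdist x y + 1 < M]) => /=.
    split; first exact: nbhsx_ballx.
    by exists (mdist x y + 1); split => //; exact: num_real.
  move=> [z M] /= []; rewrite ballEmdist /= => yz; apply: le_lt_trans.
  by rewrite (le_trans (metric_triangle _ y _))// lerD2l ltW.
exists (`|M| + 1) => [|y Ey]; first by rewrite ltr_wpDl.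
by apply: (HM (`|M| + 1)) => //; rewrite (le_lt_trans (ler_norm M))// ltrDl.
Qed.

Let hd_set E F := [set e : R | 0 < e /\ E `<=` set_nbhd F e /\ F `<=` set_nbhd E e].

Let hd_set_neq0 (E F : hyperspace X) : hd_set E F !=set0.
Proof.
have [x Ex] := hset_neq0 E; have [y Fy] := hset_neq0 F.
have [M M0 HM] := compact_mdist_bounded y (hset_compact E).
have [N N0 HN] := compact_mdist_bounded x (hset_compact F).
exists (M + N); split; first by rewrite addr_gt0.
split=> z Hz.
- by exists y => //; rewrite (lt_trans (HM _ Hz))// ltrDl.
- by exists x => //; rewrite (lt_trans (HN _ Hz))// ltrDr.
Qed.

Let hd_set_lb0 E F : lbound (hd_set E F) 0.
Proof. by move=> e [/ltW]. Qed.

Let hd_lt (E F : hyperspace X) e : hausdorff_dist E F < e ->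
  exists2 d, hd_set E F d & d < e.
Proof.
by apply: inf_lt; exact: hd_set_neq0.
Qed.

Let hd_le E F e : hd_set E F e -> hausdorff_dist E F <= e.
Proof. by move=> EFe; apply: ge_inf => //; exists 0; exact: hd_set_lb0. Qed.

Lemma hausdorff_distxx (E : hyperspace X) : hausdorff_dist E E = 0.
Proof.
apply/eqP; rewrite eq_le; apply/andP; split; last first.
  by apply: lb_le_inf; [exact: hd_set_neq0|exact: hd_set_lb0].
apply/ler_addgt0Pl => e e0; rewrite addr0; apply: hd_le; split => //.
by split => x Ex; exists x => //; rewrite mdistxx.
Qed.

Lemma hausdorff_dist_sym (E F : hyperspace X) :
  hausdorff_dist E F = hausdorff_dist F E.
Proof.
by congr inf; apply/seteqP; split => e /= [e0 [EF FE]]; split.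
Qed.

Lemma hausdorff_dist_positivity (E F : hyperspace X) :
  hausdorff_dist E F = 0 -> E = F.
Proof.
suff H (A B : hyperspace X) : hausdorff_dist A B = 0 -> hset A `<=` hset B.
  move=> EF; apply: hyperspace_inj; apply/seteqP; split; apply: H => //.
  by rewrite hausdorff_dist_sym.
move=> AB0 x Ax.
have /closure_id -> := compact_closed (@metric_hausdorff _ X) (hset_compact B).
move=> U; rewrite -nbhs_ballE => -[e /= e0 xeU].
have [|d [d0 [+ _]] de] := @hd_lt A B e; first by rewrite AB0.
move=> /(_ _ Ax)[y By yx]; exists y; split => //; apply: xeU.
by rewrite ballEmdist /= metric_sym (lt_trans yx).
Qed.

Lemma hausdorff_dist_triangle (F E G : hyperspace X) :
  hausdorff_dist E G <= hausdorff_dist E F + hausdorff_dist F G.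
Proof.
apply/ler_addgt0Pr => e e0.
have e20 : 0 < e / 2 by rewrite divr_gt0.
have /hd_lt[a [a0 [EFa FEa]] ae] :
  hausdorff_dist E F < hausdorff_dist E F + e / 2 by rewrite ltrDl.
have /hd_lt[b [b0 [FGb GFb]] be] :
  hausdorff_dist F G < hausdorff_dist F G + e / 2 by rewrite ltrDl.
apply: (@le_trans _ _ (a + b)); last first.
  by rewrite (splitr e) addrACA; apply: lerD; exact: ltW.
apply: hd_le; split; first by rewrite addr_gt0.
split=> x.
- move=> /EFa[y /FGb[z Gz zy] yx]; exists z => //.
  by rewrite (le_lt_trans (metric_triangle _ y _))// addrC ltrD.
- move=> /GFb[y /FEa[z Ez zy] yx]; exists z => //.
  by rewrite (le_lt_trans (metric_triangle _ y _))// ltrD.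
Qed.

HB.instance Definition _ := gen_eqMixin (hyperspace X).
HB.instance Definition _ := gen_choiceMixin (hyperspace X).
HB.instance Definition _ := @isMetric.Build R (hyperspace X)
  (fun E F : hyperspace X => hausdorff_dist E F) hausdorff_distxx hausdorff_dist_positivity
  hausdorff_dist_sym hausdorff_dist_triangle.

End hyperspace.

Section baire_borel.
Context {T U : topologicalType}.

Fixpoint baire_class (n : nat) (f : T -> U) : Prop :=
  if n is m.+1 then
    exists2 g : nat -> T -> U, (forall k, baire_class m (g k)) &
      forall x, g k x @[k --> \oo] --> f x
  else continuous f.

Definition borel_measurable (f : T -> U) : Prop :=
  forall B : set U, <<s [set A | open A] >> B ->
    <<s [set A | open A] >> (f @^-1` B).

End baire_borel.

Section assouad_spectrum.
Context {R : realType} {X : metricType R}.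

(* Balls are closed, both for the balls B(x, R) and for the covering balls.
   The library's [closed_ball] is not used: it is the closure of
   the open ball, which in a general metric space can be smaller. *)
Definition cball (x : X) (r : R) : set X := [set y | mdist x y <= r].

(* The centres range over the ambient space X. The value is +oo if there is no
   finite cover, which cannot happen when X is compact and r > 0. *)
Definition covering_number (E : set X) (r : R) : \bar R :=
  ereal_inf [set n%:R%:E | n in [set n : nat |
    exists c : 'I_n -> X, E `<=` \bigcup_i cball (c i) r]].

(* Extended-real valued, with inf set0 = +oo: over a compact space that is not
   doubling there may be no admissible exponent. *)
Definition assouad_spectrum (F : set X) (theta : R) : \bar R :=
  ereal_inf [set alpha%:E | alpha in [set alpha : R |
    exists2 C : R, 0 < C & exists2 rho : R, 0 < rho &
      forall r : R, 0 < r <= rho -> forall x, F x ->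
        (covering_number (cball x r `&` F) (r `^ theta^-1)
           <= (C * (r / r `^ theta^-1) `^ alpha)%:E)%E]].

End assouad_spectrum.

Definition DeltaA {R : realType} (X : metricType R)
    (p : hyperspace X * `]0, 1[%classic) : \bar R :=
  assouad_spectrum p.1 (\val p.2 : R).
Arguments DeltaA {R} X p.

(* Main.v *)
Require Import Defs.
From HB Require Import structures.
From mathcomp Require Import all_boot all_order all_algebra.
From mathcomp Require Import all_classical all_reals all_analysis.

(** Write t(r) for the ratio r / r^(1/theta), which tends to +oo as r tends to
0.  Say that F is crowded at the exponent a below the radius rho if some ball
of radius r < rho centred in F needs more than t(r)^a balls of radius
r^(1/theta) to be covered.  Since multiplicative constants are absorbed by any
increase of the exponent, the spectrum of F at theta is the threshold: F is
crowded below every radius for a smaller than the spectrum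
([not_crowded_spectrum_le]), and is no longer crowded below some radius for a
larger than the spectrum ([spectrum_lt_not_crowded]).

Being crowded is an open condition on (F, theta) ([crowded_open]).  The point
is that, X being compact and the covering balls closed, a set that cannot be
covered by m balls of radius s cannot be covered by m balls of a slightly larger
radius either ([coverable_right_closed]); this leaves room both for moving F
and for enlarging r.  Hence the supremum of the exponents a <= n at which F is crowded
below the radius 1/(n+1) is a lower semicontinuous real function of
(F, theta), and these functions converge to the spectrum.  On a space whose
topology comes from a distance, a nonnegative lower semicontinuous function
is the limit of its Lipschitz regularisations ([lsc_lim_continuous]), so the
spectrum is a limit of functions of class 1.  Truncating at n makes the
approximations real-valued, so that the same argument serves the extended-real
function and its finite part.  Borel measurability follows because measurability
passes to pointwise limits ([limit_borel_measurable]).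

For the negative part, X is a sequence of isolated points, the i-th one at
distance 1/i from the limit point, with the ultrametric for which two distinct
points are as far apart as the farther one is from the limit.  A set P of
indices gives the compact set of its points together with the limit; this
depends continuously on P for the topology of pointwise convergence.  Finite P
give spectrum 0, while cofinite P give spectrum at least 1 for theta = 1/2.
Both kinds of P are dense, and a limit of continuous functions cannot oscillate
in this way: alternating between the two kinds produces a P along which
the approximations do not converge ([baire1_oscillation]). *)

Set Implicit Arguments.
Unset Strict Implicit.
Unset Printing Implicit Defensive.

Import Order.TTheory GRing.Theory Num.Theory.
Import numFieldNormedType.Exports.

Local Open Scope classical_set_scope.
Local Open Scope ring_scope.

(** * Pointwise limits of functions and semicontinuity *)

Section baire_functions.
Context {R : realType}.

(** For an open V, f x lies in V exactly when, for some m, the values g k x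
eventually lie in the points of V whose 1/(m+1)-ball stays inside V: this margin
is what survives, in both directions, the passage to the limit. *)
Lemma limit_borel_measurable {T : topologicalType} {U : pseudoMetricType R}
    (g : nat -> T -> U) (f : T -> U) :
  (forall k, borel_measurable (g k)) ->
  (forall x, g k x @[k --> \oo] --> f x) -> borel_measurable f.
Proof.
move=> mg gf.
have [s0 sC sU] := smallest_sigma_algebra [set: T] [set A | open A].
have sCT A : <<s [set A : set T | open A] >> A ->
    <<s [set A : set T | open A] >> (~` A).
  by rewrite -setTD; exact: sC.
have sI (A : (set T)^nat) :
    (forall n, <<s [set A : set T | open A] >> (A n)) ->
    <<s [set A : set T | open A] >> (\bigcap_n A n).
  move=> mA; rewrite -[X in <<s _ >> X]setCK setC_bigcap; apply: (sCT).
  by apply: sU => n; exact: (sCT).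
rewrite /borel_measurable => B.
apply: (@smallest_sub _ _ _ [set B | <<s [set A : set T | open A] >> (f @^-1` B)]).
  split=> /=.
  - by rewrite preimage_set0.
  - by move=> A mA; rewrite setTD preimage_setC; exact: sCT.
  - by move=> A mA; rewrite preimage_bigcup; exact: sU.
move=> V oV /=.
(* The interior makes the set with margin open, hence Borel. *)
pose V_ m := interior [set y : U | ball y (m.+1%:R^-1) `<=` V].
have -> : f @^-1` V =
    \bigcup_m \bigcup_n \bigcap_k (g (n + k)%N @^-1` V_ m).
  apply/seteqP; split=> [x /= Vfx|x [m _ [n _ gV]]].
    have /nbhs_ballP[e /= e0 eV] : nbhs (f x) V by exact: open_nbhs_nbhs.
    have [m me] : exists m, m.+1%:R^-1 < e / 2.
      have [m _ /(_ m (leqnn _))] :=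
        near_infty_natSinv_lt (PosNum (divr_gt0 e0 (ltr0Sn R 1))).
      by exists m.
    exists m => //.
    have : nbhs (f x) (V_ m).
      apply/nbhs_interior/nbhs_ballP.
      exists (e / 2) => /=; first by rewrite divr_gt0.
      move=> y fxy z yz; apply: eV; rewrite (splitr e).
      by apply: ball_triangle fxy _; apply: le_ball yz; exact: ltW.
    move=> /(gf x)[n _ Hn]; exists n => // k _ /=.
    by apply: Hn => /=; rewrite leq_addr.
  have : nbhs (f x) (ball (f x) m.+1%:R^-1) by apply: nbhsx_ballx.
  move=> /(gf x)[N _ HN].
  have /= := gV N I => /interior_subset/=; apply.
  by apply: ball_sym; apply: HN => /=; rewrite leq_addl.
apply: (sU) => m; apply: (sU) => n; apply: sI => k.
by apply: mg; apply: sub_smallest; [exact: subset_refl|exact: open_interior].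
Qed.

Lemma baire_class_borel_measurable {T : topologicalType}
    {U : pseudoMetricType R} n (f : T -> U) :
  baire_class n f -> borel_measurable f.
Proof.
elim: n f => [|n IHn] f /= => [cf|[g bg gf]]; last first.
  by apply: limit_borel_measurable gf => k; exact: IHn.
rewrite /borel_measurable => B.
apply: (@smallest_sub _ _ _ [set B | <<s [set A : set T | open A] >> (f @^-1` B)]).
  have [s0 sC sU] := smallest_sigma_algebra [set: T] [set A | open A].
  split=> /=.
  - by rewrite preimage_set0.
  - by move=> A mA; rewrite setTD preimage_setC -setTD; exact: sC.
  - by move=> A mA; rewrite preimage_bigcup; exact: sU.
move=> V oV /=; apply: sub_smallest; first exact: subset_refl.
by apply: open_comp oV => x _; exact: cf.
Qed.

(** The regularisation g k p = inf over q of f q + k * d p q is k-Lipschitz and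
below f.  As k grows, points q far from p become too expensive, and near p
lower semicontinuity keeps f q above f p - e.  Any distance d that
induces the topology will do. *)
Lemma lsc_lim_continuous {T : topologicalType} (d : T -> T -> R)
    (dxx : forall p, d p p = 0) (d_sym : forall p q, d p q = d q p)
    (d_triangle : forall q p s, d p s <= d p q + d q s)
    (nbhs_d : forall p A,
      nbhs p A <-> exists2 e, 0 < e & forall q, d p q < e -> A q)
    (f : T -> R) :
  (forall p, 0 <= f p) -> (forall p a, a < f p -> \forall q \near p, a < f q) ->
  exists2 g : nat -> T -> R, (forall k, continuous (g k)) &
    forall p, g k p @[k --> \oo] --> f p.
Proof.
move=> f0 lscf.
have d0 p q : 0 <= d p q.
  rewrite -(@pmulrn_lge0 _ _ 2)// -(dxx p).
  by rewrite (le_trans (d_triangle q _ _))// (d_sym q) -mulr2n.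
pose S (k : nat) p := [set f q + k%:R * d p q | q in [set: T]].
have S0 k p : lbound (S k p) 0.
  by move=> _ [q _ <-]; rewrite addr_ge0// mulr_ge0.
have Sn0 k p : S k p !=set0 by exists (f p + k%:R * d p p); exists p.
have Sle k p q : inf (S k p) <= f q + k%:R * d p q.
  by apply: ge_inf; [exists 0; exact: S0|exists q].
have Slip k p q : inf (S k p) <= inf (S k q) + k%:R * d p q.
  rewrite -lerBlDr; apply: lb_le_inf => // _ [s _ <-].
  rewrite lerBlDr (le_trans (Sle k p s))// -addrA lerD2l -mulrDr.
  by rewrite ler_wpM2l// addrC.
exists (fun k p => inf (S k p)) => [k p|p].
  apply/cvgrPdist_lt => e e0; rewrite near_simpl; apply/nbhs_d.
  exists (e / k.+1%:R) => [|q pq]; first by rewrite divr_gt0.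
  apply: (@le_lt_trans _ _ (k%:R * d p q)).
    rewrite ler_distlC; apply/andP; split.
      by rewrite lerBlDr.
    by rewrite (le_trans (Slip k q p))// d_sym.
  apply: (@le_lt_trans _ _ (k.+1%:R * d p q)).
    by rewrite ler_wpM2r// ler_nat.
  by rewrite mulrC -ltr_pdivlMr.
apply/cvgrPdist_lt => e e0.
have : \forall q \near p, f p - e / 2 < f q.
  by apply: lscf; rewrite ltrBlDr ltrDl divr_gt0.
move=> /nbhs_d[r r0 Hr].
near=> k.
rewrite ltr_distlC; apply/andP; split; last first.
  by rewrite (le_lt_trans (Sle k p p))// dxx mulr0 addr0 ltrDl.
apply: (@lt_le_trans _ _ (f p - e / 2)).
  by rewrite ltrD2l ltrN2 gtr_pMr// invf_lt1// ltr1n.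
apply: lb_le_inf => // _ [q _ <-].
have [pq|pq] := ltP (d p q) r.
  by rewrite (le_trans (ltW (Hr _ pq)))// lerDl mulr_ge0.
apply: (@le_trans _ _ (k%:R * r)); last first.
  by rewrite (@le_trans _ _ (k%:R * d p q)) ?ler_wpM2l// lerDr.
apply: (@le_trans _ _ (f p)); first by rewrite gerBl divr_ge0// ltW.
rewrite -ler_pdivrMr//; near: k; exact: nbhs_infty_ger.
Unshelve. all: by end_near. Qed.

End baire_functions.

(** * The scale ratio r / r^(1/theta) and its powers *)

Section scales.
Context {R : realType}.
Implicit Types r x a : R.

Lemma powR_expR r x : 0 < r -> r `^ x = expR (x * ln r).
Proof. by move=> r0; rewrite /powR gt_eqF. Qed.

(** Everything about the scale ratio is read off this exponential form: for
0 < r < 1 < x both 1 - x and ln r are negative, so the ratio exceeds 1. *)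
Lemma scale_ratio_expR r x a : 0 < r ->
  (r / r `^ x) `^ a = expR (a * ((1 - x) * ln r)).
Proof.
move=> r0; rewrite -{1}(lnK r0) (powR_expR _ r0) -expRN -expRD.
by rewrite powR_expR ?expR_gt0// expRK mulrBl mul1r.
Qed.

Lemma scale_ratio_le r x a b : 0 < r < 1 -> 1 < x -> a <= b ->
  (r / r `^ x) `^ a <= (r / r `^ x) `^ b.
Proof.
move=> r01 x1 ab; have /andP[r0 _] := r01; rewrite !scale_ratio_expR// ler_expR.
apply: ler_wpM2r => //; apply: ltW; rewrite nmulr_lgt0 ?subr_lt0//.
exact: ln_lt0.
Qed.

Lemma scale_ratio_lt1 r x b : 0 < r < 1 -> 1 < x -> b < 0 ->
  (r / r `^ x) `^ b < 1.
Proof.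
move=> r01 x1 b0; have /andP[r0 _] := r01; rewrite !scale_ratio_expR//.
rewrite expR_lt1 pmulr_llt0// nmulr_lgt0 ?subr_lt0//.
exact: ln_lt0.
Qed.

(** The ratio is unbounded as r tends to 0, so a larger exponent absorbs the
constant C. *)
Lemma scale_ratio_absorb C x a b : 0 < C -> 1 < x -> a < b ->
  exists2 rho, 0 < rho & forall r, 0 < r < rho ->
    C * (r / r `^ x) `^ a <= (r / r `^ x) `^ b.
Proof.
move=> C0 x1 ab; have k0 : (b - a) * (1 - x) < 0.
  by rewrite pmulr_rlt0 ?subr_gt0// subr_lt0.
(* Solves C = ratio^(b - a) for r. *)
exists (expR (ln C / ((b - a) * (1 - x)))); first exact: expR_gt0.
move=> r /andP[r0 rrho]; rewrite !scale_ratio_expR// -{1}(lnK C0) -expRD ler_expR.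
rewrite -lerBrDr -mulrBl mulrA -ler_ndivlMl// mulrC.
by rewrite -ler_expR lnK//; exact: ltW.
Qed.

Lemma powR_cvgl r x : 0 < r -> t `^ x @[t --> r] --> r `^ x.
Proof.
move=> r0.
have : expR (x * ln t) @[t --> r] --> expR (x * ln r).
  apply: continuous_comp; last exact: continuous_expR.
  by apply: continuousM; [exact: cst_continuous|exact: continuous_ln].
rewrite -powR_expR//; apply: cvg_trans; apply: near_eq_cvg.
by near=> t; rewrite powR_expR//; near: t; exact: lt_nbhsr.
Unshelve. all: by end_near. Qed.

Lemma powR_cvgr r x : 0 < r -> r `^ t @[t --> x] --> r `^ x.
Proof.
move=> r0; rewrite powR_expR//.
under eq_fun do rewrite powR_expR//.
apply: continuous_comp; last exact: continuous_expR.
by apply: continuousM; [exact: cvg_id|exact: cst_continuous].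
Qed.

Lemma scale_ratio_cvgl r x a : 0 < r ->
  (t / t `^ x) `^ a @[t --> r] --> (r / r `^ x) `^ a.
Proof.
move=> r0; apply: (@continuous_cvg _ _ _ _ _ _ (fun u => u `^ a)).
  by apply: powR_cvgl; rewrite divr_gt0// powR_gt0.
apply: cvgM; first exact: cvg_id.
apply: cvgV; [by rewrite gt_eqF// powR_gt0|exact: powR_cvgl].
Qed.

Lemma scale_ratio_cvgr r x a : 0 < r ->
  (r / r `^ t) `^ a @[t --> x] --> (r / r `^ x) `^ a.
Proof.
move=> r0; apply: (@continuous_cvg _ _ _ _ _ _ (fun u => u `^ a)).
  by apply: powR_cvgl; rewrite divr_gt0// powR_gt0.
apply: cvgM; first exact: cvg_cst.
apply: cvgV; [by rewrite gt_eqF// powR_gt0|exact: powR_cvgr].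
Qed.

End scales.

(** * Coverings by closed balls *)

Section coverings.
Context {R : realType} {X : metricType R}.
Implicit Types (E : set X) (s a : R).

Definition coverable E s m := exists c : 'I_m -> X, E `<=` \bigcup_i cball (c i) s.

Lemma coverable_leq E s m n (x0 : X) : (m <= n)%N ->
  coverable E s m -> coverable E s n.
Proof.
move=> mn [c Ec].
(* The additional balls are centred at the arbitrary point x0. *)
exists (fun i => if insub (i : nat) is Some j then c j else x0) => y /Ec[i _ iy].
by exists (widen_ord mn i) => //=; rewrite valK.
Qed.

(** With a real bound c < m + 1, no question of whether the infimum defining
the covering number is attained arises. *)
Lemma covering_number_coverable E s c m (x0 : X) :
  (covering_number E s <= c%:E)%E -> c < m.+1%:R -> coverable E s m.
Proof.
move=> Ec cm; have /ereal_inf_lt[_ [n En <-]] : (covering_number E s < m.+1%:R%:E)%E.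
  by apply: (le_lt_trans Ec); rewrite lte_fin.
by rewrite lte_fin ltr_nat ltnS => nm; exact: coverable_leq En.
Qed.

Lemma coverable_covering_number E s m :
  coverable E s m -> (covering_number E s <= m%:R%:E)%E.
Proof. by move=> Em; apply: ereal_inf_lbound; exists m. Qed.

Lemma ultra_fmap {T U : Type} (f : T -> U) (F : set_system T) :
  UltraFilter F -> UltraFilter (f @ F).
Proof.
move=> UF; apply: Build_UltraFilter => G PG FG.
apply/seteqP; split=> // A GA; have [//|FA] := in_ultra_setVsetC (f @^-1` A) UF.
have /filterI/(_ GA) : G (~` A) by exact: FG.
by rewrite setICl => /filter_not_empty.
Qed.

(** As e tends to 0 along an ultrafilter, each of the m centres converges by
compactness, and the limits are centres of a covering of radius s: a point
at distance more than s from all the limits would be uncovered for small e. *)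
Lemma coverable_right_closed E s m : compact [set: X] ->
  (forall e, 0 < e -> coverable E (s + e) m) -> coverable E s m.
Proof.
move=> cX Es.
have /choice[c Hc] : forall e : R, exists c : 'I_m -> X,
    0 < e -> E `<=` \bigcup_i cball (c i) (s + e).
  move=> e; have [/Es[c Ec]|e0] := ltP 0 e; first by exists c.
  have [c _] := Es _ ltr01; by exists c.
have [U [UU sU]] := ultraFilterLemma (at_right_proper_filter (0 : R)).
have /choice[l Hl] : forall i, exists l : X, c e i @[e --> U] --> l.
  move=> i; move: cX; rewrite compact_ultra => /(_ ((fun e => c e i) @ U)).
  move=> /(_ (ultra_fmap _ UU) (@filterT _ U _))[l [_ Hl]].
  by exists l.
exists l => y Ey; apply: contrapT => Hy.
have [e] : exists e, 0 < e /\ forall i, s + e < mdist (c e i) y.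
  apply: (@filter_ex _ U); apply: filterI.
    by apply: sU; exact: nbhs_right_gt.
  apply: (@filter_forall _ _ _ U) => i.
  have {}Hy : s < mdist (l i) y.
    by rewrite ltNge; apply/negP => iy; apply: Hy; exists i.
  set h := (mdist (l i) y - s) / 2.
  have h0 : 0 < h by rewrite divr_gt0// subr_gt0.
  have U1 : U [set e | e < h] by apply: sU; exact: nbhs_right_lt.
  have U2 : U [set e | mdist (l i) (c e i) < h].
    have /(Hl i)// : nbhs (l i) [set z | mdist (l i) z < h].
    by rewrite -metricType_numDomainType.filter_from_mdist_nbhs; exists h.
  near=> e.
  have e1 : e < h by near: e.
  have e2 : mdist (l i) (c e i) < h by near: e.
  have e3 := metric_triangle (l i) (c e i) y.
  have hE : h + h = mdist (l i) y - s by rewrite -splitr.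
  rewrite -ltrBDl; apply: (lt_le_trans e1).
  rewrite lerBrDl -(lerD2l h) addrCA hE addrC subrK.
  by rewrite (le_trans e3)// lerD2r ltW.
move=> [e0 He]; have [i _] := Hc e e0 y Ey.
by rewrite /cball/= leNgt He.
Unshelve. all: by end_near. Qed.

End coverings.

(** * Crowded sets *)

Section crowding.
Context {R : realType} {X : metricType R}.
Implicit Types (F : hyperspace X) (a rho theta : R).

(** The witness m, with the power of the ratio below m + 1, says that the covering
number exceeds that power without computing it; since the condition on the power
is a strict inequality, it is stable under small changes of r and theta. *)
Definition crowded a rho F theta := exists r x m,
  [/\ 0 < r < rho, hset F x,
      ~ coverable (cball x r `&` F) (r `^ theta^-1) m &
      (r / r `^ theta^-1) `^ a < m.+1%:R].

Lemma hyperspace_near F F' e x : mdist F F' < e -> hset F x ->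
  exists2 y, hset F' y & mdist x y < e.
Proof.
have [p Fp] := hset_neq0 F; have [q Fq] := hset_neq0 F'.
have [M M0 HM] := compact_mdist_bounded q (@hset_compact _ _ F).
have [N N0 HN] := compact_mdist_bounded p (@hset_compact _ _ F').
move=> /inf_lt[|e' [e'0 [FF' _]] e'e /FF'[y Fy yx]].
  exists (M + N); split; first by rewrite addr_gt0.
  split=> z Hz.
  - by exists q => //; rewrite (lt_trans (HM _ Hz))// ltrDl.
  - by exists p => //; rewrite (lt_trans (HN _ Hz))// ltrDr.
by exists y => //; rewrite metric_sym (lt_trans yx).
Qed.

(** Not being coverable at radius r^(1/theta) persists at a radius larger by
some d.  Then r is enlarged to s so that s^(1/theta) uses up at most half of d and
the bound on the power still holds.  A ball of radius s centred in a nearby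
F' contains points close to every point of the original ball, and a covering of
it, blown up by e <= d/2, would cover the original ball at radius
r^(1/theta) + d. *)
Lemma crowded_open a rho F theta : compact [set: X] -> 0 < theta ->
  crowded a rho F theta ->
  exists2 e, 0 < e & forall F' theta', mdist F F' < e ->
    `|theta - theta'| < e -> crowded a rho F' theta'.
Proof.
move=> cX theta0 [r [x [m [/andP[r0 rrho] Fx ncov ram]]]].
have [d [d0 ncovd]] : exists d, 0 < d /\
    ~ coverable (cball x r `&` F) (r `^ theta^-1 + d) m.
  apply: contrapT => Hd; apply: ncov; apply: coverable_right_closed => // e e0.
  by apply: contrapT => He; apply: Hd; exists e.
have d20 : 0 < d / 2 by rewrite divr_gt0.
have [s [rs [srho sd sam]]] : exists s, r < s /\
    [/\ s < rho, s `^ theta^-1 < r `^ theta^-1 + d / 2 &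
        (s / s `^ theta^-1) `^ a < m.+1%:R].
  apply: (@filter_ex _ (r^'+)); near=> s; split.
    by near: s; exact: nbhs_right_gt.
  split.
  - by near: s; exact: nbhs_right_lt.
  - near: s; apply: (@cvg_within _ (nbhs r)).
    by apply: (cvgr_lt _ (powR_cvgl r0)); rewrite ltrDl.
  - near: s; apply: (@cvg_within _ (nbhs r)).
    exact: (cvgr_lt _ (scale_ratio_cvgl r0)).
have s0 := lt_trans r0 rs.
have cvgV : t^-1 @[t --> theta] --> theta^-1.
  by apply: cvgV; [rewrite gt_eqF|exact: cvg_id].
have [e1 /= e10 He1] : \forall t \near theta,
    s `^ t^-1 < r `^ theta^-1 + d / 2 /\ (s / s `^ t^-1) `^ a < m.+1%:R.
  near=> t; split; near: t.
    exact: (cvgr_lt _ (cvg_comp _ _ cvgV (powR_cvgr s0))).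
  exact: (cvgr_lt _ (cvg_comp _ _ cvgV (scale_ratio_cvgr s0))).
pose e := Num.min e1 (Num.min ((s - r) / 2) (d / 2)).
exists e => [|F' theta' FF' tt'].
  by rewrite !lt_min e10 d20 divr_gt0// subr_gt0.
have [e_e1 e_sr e_d] : [/\ e <= e1, e <= (s - r) / 2 & e <= d / 2].
  by rewrite /e !ge_min !lexx !orbT.
have [x' Fx' xx'] := hyperspace_near FF' Fx.
have [std sta] := He1 _ (lt_le_trans tt' e_e1).
exists s, x', m; split => //; first by rewrite s0.
move=> [c Hc]; apply: ncovd; exists c => y [/= xy Fy].
have [y' Fy' yy'] := hyperspace_near FF' Fy.
have [|i _ iy'] := Hc y'.
  split=> //=; rewrite /cball/=.
  rewrite (le_trans (metric_triangle _ x _))//.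
  rewrite (le_trans (lerD (lexx _) (metric_triangle _ y _)))//.
  rewrite -[leRHS](subrK r) (splitr (s - r)) -addrA lerD//.
    by rewrite metric_sym (le_trans (ltW xx')).
  by rewrite addrC lerD// (le_trans (ltW yy')).
exists i => //; rewrite /cball/= (le_trans (metric_triangle _ y' _))//.
rewrite [leRHS](_ : _ = r `^ theta^-1 + d / 2 + d / 2); last first.
  by rewrite -addrA -splitr.
rewrite lerD//; first exact: (le_trans iy' (ltW std)).
by rewrite metric_sym (le_trans (ltW yy')).
Unshelve. all: by end_near. Qed.

Lemma crowded_le_radius a rho rho' F theta : rho <= rho' ->
  crowded a rho F theta -> crowded a rho' F theta.
Proof.
move=> rr' [r [x [m [/andP[r0 rrho] Fx nc am]]]]; exists r, x, m; split => //.
by rewrite r0 (lt_le_trans rrho).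
Qed.

Lemma crowded_le_exponent a b rho F theta : 0 < theta < 1 -> rho <= 1 ->
  a <= b -> crowded b rho F theta -> crowded a rho F theta.
Proof.
move=> /andP[t0 t1] rho1 ab [r [x [m [/andP[r0 rrho] Fx nc bm]]]].
exists r, x, m; split => //; first by rewrite r0.
apply: le_lt_trans bm; apply: scale_ratio_le => //.
  by rewrite r0 (lt_le_trans rrho).
by rewrite invf_gt1.
Qed.

(** For a negative exponent, the power of the ratio is below 1, and no ball
centred in F is covered by the empty family. *)
Lemma crowded_lt0 a rho F theta : 0 < theta < 1 -> 0 < rho -> a < 0 ->
  crowded a rho F theta.
Proof.
move=> /andP[t0 t1] rho0 a0; have [x Fx] := hset_neq0 F.
pose r := Num.min rho 1 / 2.
have m0 : 0 < Num.min rho 1 by rewrite lt_min rho0/=.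
have rm : r < Num.min rho 1 by rewrite gtr_pMr// invf_lt1// ltr1n.
have r0 : 0 < r by rewrite divr_gt0.
exists r, x, 0%N; split => //.
- by rewrite r0 (lt_le_trans rm)// ge_min lexx.
- by move=> [c /(_ x)[|[]//]]; split => //=; rewrite /cball/= mdistxx ltW.
- apply: scale_ratio_lt1 => //; last by rewrite invf_gt1.
  by rewrite r0 (lt_le_trans rm)// ge_min lexx orbT.
Qed.

Lemma not_crowded_spectrum_le a rho F theta : 0 < rho ->
  ~ crowded a rho F theta -> (assouad_spectrum F theta <= a%:E)%E.
Proof.
move=> rho0 ncr; apply: ereal_inf_lbound; exists a => //.
exists 1 => //; exists (rho / 2); first by rewrite divr_gt0.
move=> r /andP[r0 rrho] x Fx; rewrite mul1r.
(* The constant is 1: failing to be crowded bounds the covering number by the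
   integer part of the power of the ratio. *)
set c := (r / _) `^ a.
have c0 : 0 <= c by exact: powR_ge0.
have /coverable_covering_number/le_trans :
    coverable (cball x r `&` F) (r `^ theta^-1) (Num.truncn c).
  apply: contrapT => ncov; apply: ncr; exists r, x, (Num.truncn c); split => //.
    by rewrite r0 (le_lt_trans rrho)// gtr_pMr// invf_lt1// ltr1n.
  exact: truncnS_gt.
by apply; rewrite lee_fin truncn_le.
Qed.

Lemma spectrum_lt_not_crowded b F theta : 0 < theta < 1 ->
  (assouad_spectrum F theta < b%:E)%E ->
  exists2 rho, 0 < rho & ~ crowded b rho F theta.
Proof.
move=> /andP[t0 t1] /ereal_inf_lt[_ [a [C C0 [rho rho0 HC]] <-]].
rewrite lte_fin => ab; have theta1 : 1 < theta^-1 by rewrite invf_gt1.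
have [rho' rho'0 Hrho'] := scale_ratio_absorb C0 theta1 ab.
exists (Num.min rho rho'); first by rewrite lt_min rho0.
move=> [r [x [m [/andP[r0]]]]]; rewrite lt_min => /andP[rrho rrho'] Fx + bm.
apply; apply: (@covering_number_coverable _ _ _ _ (C * (r / r `^ theta^-1) `^ a)) => //.
  by apply: HC => //; rewrite r0 ltW.
by apply: le_lt_trans bm; apply: Hrho'; rewrite r0.
Qed.

Lemma assouad_spectrum_ge0 F theta : 0 < theta < 1 ->
  (0 <= assouad_spectrum F theta)%E.
Proof.
move=> t01; rewrite leNgt; apply/negP => /ereal_inf_lt[_ [a adm <-]].
rewrite lte_fin => a0.
have /(spectrum_lt_not_crowded t01)[rho rho0] :
    (assouad_spectrum F theta < (a / 2)%:E)%E.
  apply: (@le_lt_trans _ _ a%:E); first by apply: ereal_inf_lbound; exists a.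
  by rewrite lte_fin ltr_nMr// invf_lt1// ltr1n.
by apply; apply: crowded_lt0 => //; rewrite pmulr_llt0// invr_gt0.
Qed.

End crowding.

(** * Semicontinuous approximations of the spectrum *)

Section approximation.
Context {R : realType} {X : metricType R}.
Local Notation T := (hyperspace X * `]0%R : R, 1[%classic)%type.
Implicit Types p q : T.

Definition parameter_dist p q : R := mdist p.1 q.1 + `|\val p.2 - \val q.2|.

Lemma nbhs_parameter_dist p (A : set T) :
  nbhs p A <-> exists2 e, 0 < e & forall q, parameter_dist p q < e -> A q.
Proof.
split=> [/nbhs_ballP[e /= e0 eA]|[e e0 eA]].
  exists e => // q pq; apply: eA; split.
    by rewrite ballEmdist/= (le_lt_trans _ pq)// lerDl.
  have : `|\val p.2 - \val q.2| < e.
    by rewrite (le_lt_trans _ pq)// lerDr mdist_ge0.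
  exact.
apply/nbhs_ballP; exists (e / 2) => /=; first by rewrite divr_gt0.
move=> q [pq1 pq2]; apply: eA; rewrite /parameter_dist (splitr e) ltrD//.
Qed.

Lemma theta_itv p : 0 < (\val p.2 : R) < 1.
Proof. by have := set_valP p.2; rewrite /= in_itv. Qed.

(** The exponent 0 is always included so that the supremum is over a nonempty set
of nonnegative numbers. *)
Let level_set n p : set R :=
  [set a | a = 0 \/ 0 <= a <= n%:R /\ crowded a n.+1%:R^-1 p.1 (\val p.2)].

Definition spectrum_approx n p : R := sup (level_set n p).

Let level_has_sup n p : has_sup (level_set n p).
Proof.
split; first by exists 0; left.
by exists n%:R => a [->//|[/andP[]]].
Qed.

Lemma spectrum_approx_ge0 n p : 0 <= spectrum_approx n p.
Proof. by apply: ub_le_sup; [case: (level_has_sup n p)|left]. Qed.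

(** A strict lower bound on the supremum is witnessed either by the exponent 0 or by
one exponent at which p is crowded, and then all q near p are. *)
Lemma spectrum_approx_lsc n p a : compact [set: X] ->
  a < spectrum_approx n p -> \forall q \near p, a < spectrum_approx n q.
Proof.
move=> cX /(sup_gt _)[|b [->|[/andP[b0 bn] bcr]] ab]; first by exists 0; left.
  apply/nbhs_parameter_dist; exists 1 => // q _.
  exact: (lt_le_trans ab (spectrum_approx_ge0 _ _)).
have /andP[t0 t1] := theta_itv p.
have [e e0 He] := crowded_open cX t0 bcr.
apply/nbhs_parameter_dist; exists e => // q pq; apply: (lt_le_trans ab).
apply: ub_le_sup; first by case: (level_has_sup n q).
right; split; [by rewrite b0|apply: He; apply: le_lt_trans pq].
  by rewrite lerDl.
by rewrite lerDr mdist_ge0.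
Qed.

(** Below the spectrum, p is crowded at every radius; n only has to exceed the
exponent. *)
Lemma spectrum_approx_gt p a : (a%:E < DeltaA X p)%E ->
  \forall n \near \oo, a < spectrum_approx n p.
Proof.
move=> aD; have [a0|a0] := ltP a 0.
  by apply: nearW => n; exact: (lt_le_trans a0 (spectrum_approx_ge0 _ _)).
have [b ab bD] : exists2 b, a < b & (b%:E < DeltaA X p)%E.
  move: aD; case: (DeltaA X p) => [l||//]; rewrite ?lte_fin => al.
    exists ((a + l) / 2); rewrite ?lte_fin; by [exact: midf_lt|rewrite midf_lt].
  by exists (a + 1); rewrite ?ltrDl// ltry.
near=> n; apply: (lt_le_trans ab); apply: ub_le_sup.
  by case: (level_has_sup n p).
right; split.
  rewrite (le_trans a0 (ltW ab))/=; near: n; exact: nbhs_infty_ger.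
apply: contrapT => /not_crowded_spectrum_le; rewrite invr_gt0 ltr0Sn => /(_ isT).
by rewrite leNgt bD.
Unshelve. all: by end_near. Qed.

(** Above the spectrum, p is not crowded below some rho, hence neither below
1/(n+1) < rho nor at any larger exponent. *)
Lemma spectrum_approx_le p b : (DeltaA X p < b%:E)%E ->
  \forall n \near \oo, spectrum_approx n p <= b.
Proof.
move=> Db; have t01 := theta_itv p.
have [rho rho0 ncr] := spectrum_lt_not_crowded t01 Db.
have b0 : 0 <= b.
  by rewrite -lee_fin; apply: (le_trans (assouad_spectrum_ge0 _ t01) (ltW Db)).
have := near_infty_natSinv_lt (PosNum rho0).
apply: filterS => n /= nrho; apply: sup_le_ub; first by exists 0; left.
move=> a [->//|[_ acr]]; rewrite leNgt; apply/negP => ba; apply: ncr.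
apply: (crowded_le_radius (ltW nrho)); apply: crowded_le_exponent acr => //.
  by rewrite invf_le1// ler1n.
exact: ltW.
Qed.

Lemma cvg_spectrum_approx_fin p l : DeltaA X p = l%:E ->
  spectrum_approx n p @[n --> \oo] --> l.
Proof.
move=> Dl; apply/cvgrPdist_le => e e0; near=> n.
rewrite ler_distlC; apply/andP; split; last first.
  by near: n; apply: spectrum_approx_le; rewrite Dl lte_fin ltrDl.
apply: ltW; near: n; apply: spectrum_approx_gt.
by rewrite Dl lte_fin ltrBlDr ltrDl.
Unshelve. all: by end_near. Qed.

Lemma cvg_spectrum_approx p :
  (spectrum_approx n p)%:E @[n --> \oo] --> DeltaA X p.
Proof.
case Dp : (DeltaA X p) => [l||].
- by apply: cvg_EFin; [exact: nearW|exact: cvg_spectrum_approx_fin].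
- apply/cvgeyPgt => a; have : (a%:E < DeltaA X p)%E by rewrite Dp ltry.
  by move=> /spectrum_approx_gt; apply: filterS => n; rewrite lte_fin.
- by have := assouad_spectrum_ge0 p.1 (theta_itv p); rewrite -/(DeltaA X p) Dp.
Qed.

Lemma spectrum_approx_baire1 n : compact [set: X] ->
  baire_class 1 (spectrum_approx n) /\
  baire_class 1 (fun p => (spectrum_approx n p)%:E).
Proof.
move=> cX; have [|p q|q p s|||g cg gf] := @lsc_lim_continuous R T parameter_dist
    _ _ _ nbhs_parameter_dist (spectrum_approx n).
- by move=> p; rewrite /parameter_dist mdistxx subrr normr0 addr0.
- by rewrite /parameter_dist metric_sym distrC.
- rewrite /parameter_dist addrACA lerD ?metric_triangle//.
  exact: ler_distD.
- exact: spectrum_approx_ge0.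
- by move=> p a; exact: spectrum_approx_lsc.
split; first by exists g.
exists (fun k p => (g k p)%:E) => [k p|p].
  by apply: cvg_EFin; [exact: nearW|exact: cg].
by apply: cvg_EFin; [exact: nearW|exact: gf].
Qed.

Lemma DeltaA_baire2 : compact [set: X] -> baire_class 2 (DeltaA X).
Proof.
move=> cX; exists (fun n p => (spectrum_approx n p)%:E) => [n|p].
  by case: (spectrum_approx_baire1 n cX).
exact: cvg_spectrum_approx.
Qed.

Lemma fine_DeltaA_baire2 : compact [set: X] ->
  (forall p, DeltaA X p \is a fin_num) ->
  baire_class 2 (fun p => fine (DeltaA X p)).
Proof.
move=> cX fD; exists (fun n p => spectrum_approx n p) => [n|p].
  by case: (spectrum_approx_baire1 n cX).
by apply: cvg_spectrum_approx_fin; rewrite fineK.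
Qed.

End approximation.

(** * An obstruction to being of class 1 *)

Section oscillation.
Context {R : realType} {T : topologicalType}.

(** Boolean sequences play the role of a complete space in which the finite
and the cofinite ones are dense.  If g k converges to f, any finite pattern can
be extended by zeros until some late g k is frozen below 1/3 on all
continuations, then by ones until some late g l is frozen above 2/3, and so on.
For the sequence obtained in the limit, g k takes both kinds of values
infinitely often, so it does not converge. *)
Lemma baire1_oscillation (f : T -> \bar R) (phi : (nat -> bool) -> T) :
  (forall P A, nbhs (phi P) A ->
     exists n, forall Q, (forall i, (i < n)%N -> Q i = P i) -> A (phi Q)) ->
  (forall P n, (forall i, (n <= i)%N -> P i = false) -> (f (phi P) <= 0)%E) ->
  (forall P n, (forall i, (n <= i)%N -> P i = true) -> (1 <= f (phi P))%E) ->
  ~ baire_class 1 f.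
Proof.
move=> phi_cont f_fin f_cofin [g gc gf].
pose lo : R := 3^-1; pose hi : R := 2 / 3.
have lo0 : 0 < lo by rewrite invr_gt0.
have lohi : lo < hi by rewrite /hi ltr_pMl// ltr1n.
have hi1 : hi < 1 by rewrite ltr_pdivrMr// mul1r ltr_nat.
pose agree n (P Q : nat -> bool) := forall i, (i < n)%N -> Q i = P i.
(* An open condition satisfied by f at P holds for some late g k at all sequences
   that share a long enough prefix with P. *)
have freeze (V : set \bar R) P n : open V -> V (f (phi P)) ->
    exists k m, (n <= k)%N /\ forall Q, agree m P Q -> V (g k (phi Q)).
  move=> oV VP; have nV : nbhs (f (phi P)) V by exact: open_nbhs_nbhs.
  have [N _ HN] := gf _ _ nV.
  have Vk : V (g (maxn n N) (phi P)) by apply: HN => /=; exact: leq_maxr.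
  have /phi_cont[m Hm] := gc (maxn n N) (phi P) _ (open_nbhs_nbhs (conj oV Vk)).
  by exists (maxn n N), m; split; [exact: leq_maxl|exact: Hm].
(* A state is a sequence with the length of its decided prefix; that length also
   serves as lower bound for the indices k and l. *)
pose step (s t : (nat -> bool) * nat) :=
  [/\ (s.2 < t.2)%N, agree s.2 s.1 t.1 &
   exists k l, [/\ (s.2 <= k)%N, (s.2 <= l)%N & forall Q, agree t.2 t.1 Q ->
     (g k (phi Q) < lo%:E)%E /\ (hi%:E < g l (phi Q))%E]].
have stepP s : {t | step s t}.
  apply: cid; case: s => P n.
  pose P0 i := (i < n)%N && P i.
  have [||k [m [nk Hk]]] := freeze [set x | (x < lo%:E)%E] P0 n.
  - exact: open_ereal_lt_ereal.
  - apply: (@le_lt_trans _ _ 0%E); last by rewrite lte_fin.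
    by apply: (f_fin _ n) => i ni; rewrite /P0 ltnNge ni.
  pose P1 i := (maxn n m <= i)%N || P0 i.
  have [||l [m' [nl Hl]]] := freeze [set x | (hi%:E < x)%E] P1 n.
  - exact: open_ereal_gt_ereal.
  - apply: (@lt_le_trans _ _ 1%E); first by rewrite lte_fin.
    by apply: (f_cofin _ (maxn n m)) => i ni; rewrite /P1 ni.
  (* The successor forces the decided prefix to grow at every step. *)
  exists (P1, (maxn (maxn n m) m').+1); split => /=.
  - by rewrite ltnS -maxnA leq_maxl.
  - by move=> i ni; rewrite /P1 /P0 ni /= leqNgt leq_max ni.
  - exists k, l; split=> // Q QP1; split.
      apply: Hk => i im; rewrite QP1 /P1.
        by rewrite leqNgt leq_max im orbT.
      by rewrite ltnS !leq_max (ltnW im) orbT.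
    by apply: Hl => i im; apply: QP1; rewrite ltnS leq_max (ltnW im) orbT.
have [s [_ sS]] := dependent_choice stepP (fun=> false, 0%N).
have n_mono i j : (i <= j)%N -> ((s i).2 <= (s j).2)%N.
  move=> /subnKC <-; elim: (j - i)%N => [|d IH]; first by rewrite addn0.
  by rewrite addnS (leq_trans IH)//; have [/ltnW] := sS (i + d)%N.
have n_ge j : (j <= (s j).2)%N.
  by elim: j => // j IH; have [+ _ _] := sS j; apply: leq_ltn_trans.
have agree_le i j : (i <= j)%N -> agree (s i).2 (s i).1 (s j).1.
  move=> /subnKC <-; elim: (j - i)%N => [|d IH] x xi; first by rewrite addn0.
  rewrite addnS -(IH x xi); have [_ + _] := sS (i + d)%N; apply.
  by rewrite (leq_trans xi)// n_mono// leq_addr.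
pose S i := (s i.+1).1 i.
have agreeS j : agree (s j).2 (s j).1 S.
  move=> i ij; rewrite /S; have [ji|/ltnW ij'] := leqP j i.+1.
    exact: agree_le.
  by rewrite (agree_le _ _ ij')// n_ge.
have [fS|fS] := ltP (f (phi S)) hi%:E.
  have nV : nbhs (f (phi S)) [set x | (x < hi%:E)%E].
    by apply: open_nbhs_nbhs; split => //; exact: open_ereal_lt_ereal.
  have [N _ HN] := gf _ _ nV.
  have [_ _ [k [l [_ Nl /(_ _ (agreeS _))[_]]]]] := sS N.
  by apply/negP; rewrite -leNgt ltW//; apply: HN; exact: leq_trans (n_ge N) Nl.
have nV : nbhs (f (phi S)) [set x | (lo%:E < x)%E].
  apply: open_nbhs_nbhs; split => /=; first exact: open_ereal_gt_ereal.
  by apply: lt_le_trans fS; rewrite lte_fin.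
have [N _ HN] := gf _ _ nV.
have [_ _ [k [l [Nk _ /(_ _ (agreeS _))[+ _]]]]] := sS N.
by apply/negP; rewrite -leNgt ltW//; apply: HN; exact: leq_trans (n_ge N) Nk.
Qed.

End oscillation.

(** * A compact space whose spectrum oscillates *)

(** The point 0 is the limit point and i > 0 stands for the isolated point at
distance 1/i from it.  The convention 0^-1 = 0 lets a single formula give
the distances, those to the limit included. *)
Definition star (R : realType) : Type := nat.

Section star_metric.
Context {R : realType}.
Local Notation X := (star R).

HB.instance Definition _ := Choice.on X.

Definition star_dist (i j : X) : R :=
  if i == j then 0 else Num.max (i : nat)%:R^-1 (j : nat)%:R^-1.

Lemma star_distxx i : star_dist i i = 0.
Proof. by rewrite /star_dist eqxx. Qed.

Lemma star_dist_sym i j : star_dist i j = star_dist j i.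
Proof. by rewrite /star_dist eq_sym maxC. Qed.

Lemma star_dist_positivity i j : star_dist i j = 0 -> i = j.
Proof.
rewrite /star_dist; have [//|ij /eqP] := eqVneq i j.
rewrite eq_le ge_max !invr_le0 => /andP[/andP[]].
by rewrite !lern0 => /eqP-> /eqP->.
Qed.

Lemma star_dist_triangle j i k : star_dist i k <= star_dist i j + star_dist j k.
Proof.
have [<-|ij] := eqVneq i j; first by rewrite star_distxx add0r.
have [<-|jk] := eqVneq j k; first by rewrite star_distxx addr0.
rewrite /star_dist (negbTE ij) (negbTE jk); case: ifP => _.
  by rewrite addr_ge0// le_max invr_ge0 ler0n.
rewrite ge_max; apply/andP.
by split; [rewrite -[leLHS]addr0|rewrite -[leLHS]add0r]; apply: lerD;
  rewrite le_max ?lexx ?invr_ge0 ?ler0n ?orbT.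
Qed.

HB.instance Definition _ := @isMetric.Build R X star_dist star_distxx
  star_dist_positivity star_dist_sym star_dist_triangle.

(** A ball of radius below 1/j contains j only if it is centred at j. *)
Lemma star_dist_lt (i j : X) (e : R) :
  star_dist i j < e -> e <= (j : nat)%:R^-1 -> i = j.
Proof.
rewrite /star_dist; have [//|ij] := eqVneq i j.
by rewrite gt_max => /andP[_ je] /(lt_le_trans je); rewrite ltxx.
Qed.

End star_metric.

Section star_space.
Context {R : realType}.
Local Notation X := (star R).

Lemma star_mdist0 (i : X) : mdist (0%N : X) i = (i : nat)%:R^-1 :> R.
Proof.
rewrite /mdist/= /star_dist; have [<-|_] := eqVneq; first by rewrite invr0.
by rewrite invr0 max_r// invr_ge0.
Qed.

(** An ultrafilter either contains a singleton, and converges to it, or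
avoids every finite set, and converges to the limit point. *)
Lemma star_compact (A : set X) : A 0%N -> compact A.
Proof.
move=> A0; rewrite compact_ultra => U UU UA.
have [[i Ui]|Ui] := pselect (exists i, U [set i]).
  have [_ [-> Ai]] := filter_ex (filterI Ui UA).
  exists i; split=> // V Vi; apply: filterS Ui => _ ->; exact: nbhs_singleton.
have Un n : U [set i : X | (n <= i)%N].
  elim: n => [|n IH]; first by apply: filterS filterT.
  have [Un|Un] := in_ultra_setVsetC [set (n : X)] UU.
    by exfalso; apply: Ui; exists n.
  apply: filterS (filterI IH Un) => i [/= ni i_n].
  by rewrite ltn_neqAle ni andbT; apply/eqP => n_i; apply: i_n.
exists 0%N; split=> // V /nbhs_ballP[e /= e0 eV].
have [n _ /(_ n (leqnn _))/= ne] := near_infty_natSinv_lt (PosNum e0).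
apply: filterS (Un n.+1) => i /= ni; apply: eV; rewrite ballEmdist/= star_mdist0.
by apply: le_lt_trans ne; rewrite lef_pV2 ?posrE ?ltr0n ?ler_nat// (leq_trans _ ni).
Qed.

Definition star_set (P : nat -> bool) : set X := [set i : X | i = 0%N \/ P i].

Lemma star_set_neq0 P : star_set P !=set0. Proof. by exists 0%N; left. Qed.

Lemma star_set_compact P : compact (star_set P).
Proof. by apply: star_compact; left. Qed.

Definition star_hyper P : hyperspace X :=
  Hyperspace (@star_set_neq0 P) (@star_set_compact P).

(** Two sets that agree on the indices below n differ only by points within 1/n of
the limit point, which belongs to both. *)
Lemma star_hyper_near P (A : set (hyperspace X)) : nbhs (star_hyper P) A ->
  exists n, forall Q, (forall i, (i < n)%N -> Q i = P i) -> A (star_hyper Q).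
Proof.
move=> /nbhs_ballP[e /= e0 eA].
have e20 : 0 < e / 2 by rewrite divr_gt0.
have [n _ /(_ n (leqnn _))/= ne] := near_infty_natSinv_lt (PosNum e20).
exists n.+1 => Q QP; apply: eA; rewrite ballEmdist/=.
have half Q1 Q2 : (forall i, (i < n.+1)%N -> Q1 i = Q2 i) ->
    star_set Q1 `<=` set_nbhd (star_set Q2) (e / 2).
  move=> Q12 i [->|Q1i].
    by exists 0%N; [left|rewrite mdistxx].
  have [ni|ni] := ltnP i n.+1.
    by exists i; [right; rewrite -Q12|rewrite mdistxx].
  exists 0%N; first by left.
  rewrite star_mdist0; apply: le_lt_trans ne.
  by rewrite lef_pV2 ?posrE ?ltr0n ?ler_nat// (leq_trans _ ni).
apply: (@le_lt_trans _ _ (e / 2)); last first.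
  by rewrite gtr_pMr// invf_lt1// ltr1n.
apply: ge_inf; first by exists 0 => x [/ltW].
by split=> //; split; apply: half => // i ni; rewrite QP.
Qed.

(** The points with index above 1/s are all in the ball around the limit point. *)
Lemma star_coverable (E : set X) (s : R) : 0 < s ->
  coverable E s (Num.truncn s^-1).+1.
Proof.
move=> s0; exists (fun i => i : nat) => i _.
have [iK|iK] := ltnP i (Num.truncn s^-1).+1.
  by exists (Ordinal iK) => //=; rewrite /cball/= mdistxx ltW.
exists ord0 => //=; rewrite /cball/= star_mdist0.
rewrite -[leRHS]invrK lef_pV2 ?posrE ?invr_gt0 ?ltr0n ?(leq_trans _ iK)//.
by rewrite (le_trans (ltW (truncnS_gt _)))// ler_nat.
Qed.

(** The whole space needs at most 1 + 1/s balls of radius s, and for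
s = r^(1/theta) the number 1/s is the power of the ratio with exponent
(1/theta) / (1/theta - 1) = 1 / (1 - theta). *)
Lemma star_spectrum_fin (F : hyperspace X) (theta : R) : 0 < theta < 1 ->
  assouad_spectrum F theta \is a fin_num.
Proof.
move=> t01; rewrite ge0_fin_numE; last exact: assouad_spectrum_ge0.
have /andP[t0 t1] := t01; set x := theta^-1.
have x1 : 1 < x by rewrite invf_gt1.
have x10 : x - 1 != 0 by rewrite subr_eq0 gt_eqF.
apply: (@le_lt_trans _ _ (x / (x - 1))%:E); last by rewrite ltry.
apply: ereal_inf_lbound; exists (x / (x - 1)) => //.
exists 2 => //; exists 1 => // r /andP[r0 r1] y Fy.
have s0 : 0 < r `^ x by rewrite powR_gt0.
apply: (le_trans (coverable_covering_number (star_coverable _ s0))).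
rewrite lee_fin scale_ratio_expR//.
have -> : x / (x - 1) * ((1 - x) * ln r) = - (x * ln r).
  by rewrite mulrA -(opprB x 1) mulrN divfK// mulNr.
rewrite expRN -powR_expR// -natr1 mulr2n mulrDl mul1r lerD//.
  by rewrite truncn_le invr_ge0 ltW.
rewrite invf_ge1// powR_expR// -expR0 ler_expR pmulr_rle0 ?ln_le0//.
exact: lt_trans x1.
Qed.

Lemma star_finite_spectrum P n (theta : R) :
  (forall i, (n <= i)%N -> P i = false) ->
  (assouad_spectrum (star_hyper P) theta <= 0)%E.
Proof.
move=> Pn; apply: ereal_inf_lbound; exists 0 => //.
exists n.+1%:R => //; exists 1 => // r /andP[r0 _] x _; rewrite powRr0 mulr1.
apply: coverable_covering_number; exists (fun i => i : nat) => i [_ Pi].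
have i_n : (i < n.+1)%N.
  case: Pi => [->//|Pi]; rewrite ltnS leqNgt; apply/negP => /ltnW/Pn.
  by rewrite Pi.
by exists (Ordinal i_n) => //=; rewrite /cball/= mdistxx powR_ge0.
Qed.

(** At scale r = 1/m, with r^(1/theta) = 1/m^2, the ball around the limit
contains the points m, ..., 2m, each at distance more than 1/m^2 from all others.
They are m + 1 in number, more than the ratio m, so the set is crowded at the
exponent 1 below every radius. *)
Lemma star_cofinite_spectrum P n :
  (forall i, (n <= i)%N -> P i = true) ->
  (1 <= assouad_spectrum (star_hyper P) (2^-1 : R))%E.
Proof.
move=> Pn; rewrite leNgt; apply/negP => /spectrum_lt_not_crowded[|rho rho0].
  by rewrite invr_gt0 ltr0Sn/= invf_lt1// ltr1n.
apply.
have [N _ /(_ _ (leqnn _))/= Nrho] := near_infty_natSinv_lt (PosNum rho0).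
(* Index at least n for the points to be in the set, more than N for 1/m to be
   below rho, and at least 3 for 2m to be below m^2. *)
pose m := (n + N + 3)%N.
have m0 : 0 < m%:R :> R by rewrite ltr0n /m addn3.
have mV0 : 0 < m%:R^-1 :> R by rewrite invr_gt0.
have sE : (m%:R^-1 : R) `^ (2^-1)^-1 = (m ^ 2)%:R^-1.
  by rewrite invrK powR_mulrn ?ltW// natrX exprVn.
exists m%:R^-1, (0%N : X), m; split.
- rewrite mV0/=; apply: le_lt_trans Nrho.
  rewrite lef_pV2 ?posrE ?ltr0Sn// ler_nat /m addn3.
  by do 2!apply: leqW; rewrite ltnS leq_addl.
- by left.
- rewrite sE => -[c Hc].
  have in_cover (j : 'I_m.+1) : exists i, cball (c i) ((m ^ 2)%:R^-1) (m + j)%N.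
    have [|i _ ij] := Hc (m + j)%N; last by exists i.
    split=> /=; last by right; apply: Pn; rewrite /m -!addnA leq_addr.
    rewrite /cball/= star_mdist0 lef_pV2 ?posrE ?ler_nat ?leq_addr//.
    by rewrite ltr0n addn_gt0 -(ltr0n R) m0.
  have [f Hf] := choice in_cover.
  have fc (j : 'I_m.+1) : c (f j) = (m + j)%N.
    have jm2 : (m + j < m ^ 2)%N.
      apply: (@leq_ltn_trans (2 * m)).
        by rewrite mul2n -addnn leq_add2l -ltnS.
      by rewrite expnS expn1 ltn_mul2r -(ltr0n R) m0 /m addn3.
    have mj : (0 < m + j)%N by rewrite addn_gt0 -(ltr0n R) m0.
    have := Hf j; rewrite /cball/= => cj.
    apply: (@star_dist_lt R _ _ (m + j)%:R^-1) => //.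
    apply: (le_lt_trans cj); rewrite ltf_pV2 ?posrE ?ltr0n ?ltr_nat//.
    exact: leq_ltn_trans jm2.
  (* Each of the m + 1 points is the centre of the ball that covers it. *)
  have f_inj : injective f.
    by move=> j k fjk; apply/val_inj/(@addnI m); rewrite -!fc fjk.
  by have := leq_card f f_inj; rewrite !card_ord ltnn.
- rewrite sE powRr1; last by rewrite divr_ge0// ltW.
  by rewrite invrK natrX expr2 mulKf ?gt_eqF// ltr_nat.
Qed.

End star_space.

(** * The Baire class of the Assouad spectrum *)

Theorem theorem5p1 (R : realType) :
  (forall X : metricType R, [set: X] !=set0 -> compact [set: X] ->
    [/\ baire_class 2 (DeltaA X),
        borel_measurable (DeltaA X) &
        (forall p, DeltaA X p \is a fin_num) ->
          baire_class 2 (fun p => fine (DeltaA X p)) /\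
          borel_measurable (fun p => fine (DeltaA X p))]) /\
  (exists X : metricType R,
    [/\ [set: X] !=set0, compact [set: X],
        forall p, DeltaA X p \is a fin_num,
        ~ baire_class 1 (DeltaA X) &
        ~ baire_class 1 (fun p => fine (DeltaA X p))]).
Proof.
split=> [X _ cX|].
  have b2 := DeltaA_baire2 cX; split => //.
    exact: baire_class_borel_measurable b2.
  move=> fD; have fb2 := fine_DeltaA_baire2 cX fD; split => //.
  exact: baire_class_borel_measurable fb2.
pose X := star R : metricType R.
have fD p : DeltaA X p \is a fin_num.
  exact: star_spectrum_fin (theta_itv p).
have half01 : (2^-1 : R) \in (`]0%R, 1[%classic : set R).
  by rewrite inE/= in_itv/= invr_gt0 ltr0Sn/= invf_lt1// ltr1n.
pose half : (`]0%R : R, 1[%classic : set R) := SigSub half01.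
have nb1 : ~ baire_class 1 (DeltaA X).
  apply: (@baire1_oscillation R _ _ (fun P => (star_hyper P, half))).
  - move=> P A [[B C] /= [nB nC] BCA]; have [n Hn] := star_hyper_near nB.
    exists n => Q QP; apply: BCA; split; [exact: Hn|exact: nbhs_singleton].
  - by move=> P n Pn; exact: star_finite_spectrum Pn.
  - by move=> P n Pn; exact: star_cofinite_spectrum Pn.
exists X; split; [by exists 0%N|exact: star_compact|exact: fD|exact: nb1|].
move=> [g cg gf]; apply: nb1; exists (fun k p => (g k p)%:E) => [k p|p].
  by apply: cvg_EFin; [exact: nearW|exact: cg].
by rewrite -(fineK (fD p)); apply: cvg_EFin; [exact: nearW|exact: gf].
Qed.
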